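(* For every $n\in\mathbb{N}$ and every $A\in\mathcal{S}_+^n\setminus\{0\}$, $$\gamma_+(A)\le \sqrt{n}\cdot\min\{\mathrm{rk}(A),\sqrt{n}\}\cdot\|A\|_{1,1}.$$
   Context: Let $\mathbb{F}$ be $\mathbb{R}$ or $\mathbb{C}$. $\mathcal{S}_+^n$ is the cone of positive semidefinite self-adjoint $n\times n$ matrices over $\mathbb{F}$; $\mathrm{rk}(A)$ is the rank of $A$; $\|A\|_{1,1}=\sum_{k,l=1}^n|A(k,l)|$; $\|x\|_1=\sum_i|x(i)|$; and $\gamma_+(A) := \inf\{\sum_{k=1}^N \|x_k\|_1^2 : N\in\mathbb{N},\ x_k\in\mathbb{F}^n,\ A = \sum_{k=1}^N x_kx_k^*\}$. *)

(* Defs.v *)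
From mathcomp Require Import all_boot all_order all_algebra.
From mathcomp Require Import sesquilinear complex.
From mathcomp Require Import boolp classical_sets reals constructive_ereal ereal.

Set Implicit Arguments.
Unset Strict Implicit.
Unset Printing Implicit Defensive.
Import Order.TTheory GRing.Theory Num.Theory.

Local Open Scope ring_scope.
Local Open Scope classical_set_scope.
Local Open Scope sesquilinear_scope.

(* The scalar field F, which is R or R[i], comes with its conjugation [conj]
   and its modulus [nrm] taken as an R-valued function: the library norm on
   R[i] takes its values in R[i], and [Num.conj] is not available on R. *)
Section ScalarField.
Variables (R : realType) (F : numFieldType) (conj : F -> F) (nrm : F -> R).

(* In the order of R[i], [0 <= z] means that z is real and nonnegative. *)
Definition psdmx n (A : 'M[F]_n) : Prop :=
  A ^t conj = A /\ forall x : 'cV[F]_n, 0 <= (x ^t conj *m A *m x) 0 0.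

Definition norm1 n (x : 'cV[F]_n) : R := \sum_i nrm (x i 0).

Definition norm11 n (A : 'M[F]_n) : R := \sum_k \sum_l nrm (A k l).

(* The infimum is taken in the extended reals, so that it is +oo when A has
   no decomposition (over R, [inf set0] would be 0). *)
Definition gamma_plus n (A : 'M[F]_n) : \bar R :=
  ereal_inf [set s | exists (N : nat) (x : 'I_N -> 'cV[F]_n),
    A = \sum_k x k *m (x k) ^t conj /\ s = (\sum_k norm1 (x k) ^+ 2)%:E].

End ScalarField.

(* Main.v *)
(** Deflating eigenvectors one at a time writes A as a sum of at most rk(A)
    terms x x^* with A x = |x|_2^2 x. For each of them
    |x|_2^2 |x|_1 = |A x|_1 <= |A|_{1,1} |x|_oo <= |A|_{1,1} |x|_2 and
    |x|_1 <= sqrt n |x|_2, hence |x|_1^2 <= sqrt n |A|_{1,1}. Alternatively, by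
    Cauchy-Schwarz, the sum of the |x|_1^2 is at most n times the sum of the
    |x|_2^2, that is n tr A <= n |A|_{1,1}. *)
Require Import Defs.
From mathcomp Require Import all_boot all_order all_algebra.
From mathcomp Require Import sesquilinear complex.
From mathcomp Require Import boolp classical_sets reals constructive_ereal ereal.
From mathcomp Require Import spectral ring.

Set Implicit Arguments.
Unset Strict Implicit.
Unset Printing Implicit Defensive.
Import Order.TTheory GRing.Theory Num.Theory.

Local Open Scope ring_scope.
Local Open Scope sesquilinear_scope.

(** Lagrange's identity: the double sum of all [(a i - a j) ^+ 2] is twice the difference of the two
    sides. This is Cauchy-Schwarz against the all-ones vector. *)
Lemma sqr_sum_le (R : realDomainType) n (a : 'I_n -> R) :
  (\sum_i a i) ^+ 2 <= n%:R * \sum_i a i ^+ 2.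
Proof.
have : 0 <= \sum_i \sum_j (a i - a j) ^+ 2.
  by apply: sumr_ge0 => i _; apply: sumr_ge0 => j _; exact: sqr_ge0.
have -> : \sum_i \sum_j (a i - a j) ^+ 2 =
    (n%:R * \sum_i a i ^+ 2 - (\sum_i a i) ^+ 2) *+ 2.
  transitivity (\sum_i (a i ^+ 2 *+ n - a i * (\sum_j a j) *+ 2 +
                        \sum_j a j ^+ 2)).
    apply: eq_bigr => i _; under eq_bigr do rewrite sqrrB.
    by rewrite !big_split /= sumr_const card_ord sumrN sumrMnl mulr_sumr.
  rewrite !big_split /= sumr_const card_ord sumrN !sumrMnl -mulr_suml.
  by rewrite -[_ *+ n]mulr_natl expr2; ring.
by rewrite pmulrn_lge0 // subr_ge0.
Qed.

Section ScalarField.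
Variables (R : realType) (F : numFieldType).
(* [iota] embeds the reals into the scalar field, so that the real and complex
   cases share one proof; only [eigenpair] needs a separate argument. *)
Variables (cj : {rmorphism F -> F}) (nrm : F -> R) (iota : {rmorphism R -> F}).
Hypothesis cjK : involutive cj.
Hypothesis cj_iota : forall r, cj (iota r) = iota r.
Hypothesis iota_ge0 : forall r, (0 <= iota r) = (0 <= r).
Hypothesis cj_mul : forall z, cj z * z = iota (nrm z ^+ 2).
Hypothesis nrm_ge0 : forall z, 0 <= nrm z.
Hypothesis nrmM : {morph nrm : y z / y * z}.
Hypothesis nrmD : forall y z, nrm (y + z) <= nrm y + nrm z.
Hypothesis eigenpair : forall n (A : 'M[F]_n), A ^t cj = A -> A != 0 ->
  exists (l : R) (v : 'cV[F]_n), [/\ l != 0, v != 0 & A *m v = iota l *: v].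

Let iota_inj : injective iota. Proof. exact: fmorph_inj. Qed.

(** * Squared Euclidean norm and conjugate transpose *)

Definition sqnorm n (x : 'cV[F]_n) : R := \sum_i nrm (x i 0) ^+ 2.

Lemma sqnorm_ge0 n (x : 'cV[F]_n) : 0 <= sqnorm x.
Proof. by apply: sumr_ge0 => i _; exact: sqr_ge0. Qed.

Lemma nrm0 : nrm 0 = 0.
Proof.
apply/eqP; rewrite -sqrf_eq0; apply/eqP/iota_inj.
by rewrite -cj_mul mulr0 rmorph0.
Qed.

Lemma nrm_eq0 z : nrm z = 0 -> z = 0.
Proof.
move=> z0; have /eqP := cj_mul z.
by rewrite z0 expr0n /= rmorph0 mulf_eq0 fmorph_eq0 orbb => /eqP.
Qed.

Lemma nrm_iota_sqr r : nrm (iota r) ^+ 2 = r ^+ 2.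
Proof. by apply: iota_inj; rewrite -cj_mul cj_iota -rmorphM. Qed.

Lemma nrm_iota r : 0 <= r -> nrm (iota r) = r.
Proof.
by move=> r0; apply/eqP; rewrite -(@eqrXn2 _ 2) ?nrm_iota_sqr.
Qed.

Lemma nrm_sum I (s : seq I) (f : I -> F) :
  nrm (\sum_(i <- s) f i) <= \sum_(i <- s) nrm (f i).
Proof.
elim/big_rec2: _ => [|i y z _ le]; first by rewrite nrm0.
by apply: le_trans (nrmD _ _) _; rewrite lerD2l.
Qed.

Lemma sqnorm_eq0 n (x : 'cV[F]_n) : (sqnorm x == 0) = (x == 0).
Proof.
apply/idP/eqP => [|->]; last first.
  by rewrite /sqnorm big1 // => i _; rewrite mxE nrm0 expr0n.
rewrite psumr_eq0 => [/allP x0|i _]; last exact: sqr_ge0.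
apply/colP => i; rewrite mxE; apply: nrm_eq0; apply/eqP.
by have := x0 i (mem_index_enum i); rewrite sqrf_eq0.
Qed.

Lemma ctmx_mul n (x : 'cV[F]_n) : x ^t cj *m x = (iota (sqnorm x))%:M.
Proof.
rewrite [LHS]mx11_scalar; congr _%:M; rewrite mxE /sqnorm rmorph_sum.
by apply: eq_bigr => i _; rewrite !mxE cj_mul.
Qed.

Lemma ctmxK m n (B : 'M[F]_(m, n)) : (B ^t cj) ^t cj = B.
Proof. by apply/matrixP => i j; rewrite !mxE cjK. Qed.

Lemma ctmxM m n p (B : 'M[F]_(m, n)) (C : 'M_(n, p)) :
  (B *m C) ^t cj = C ^t cj *m B ^t cj.
Proof. by rewrite trmx_mul map_mxM. Qed.

Lemma ctmxD m n (B C : 'M[F]_(m, n)) : (B + C) ^t cj = B ^t cj + C ^t cj.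
Proof. by apply/matrixP => i j; rewrite !mxE rmorphD. Qed.

Lemma ctmxN m n (B : 'M[F]_(m, n)) : (- B) ^t cj = - (B ^t cj).
Proof. by apply/matrixP => i j; rewrite !mxE rmorphN. Qed.

Lemma ctmxZ m n a (B : 'M[F]_(m, n)) : (a *: B) ^t cj = cj a *: B ^t cj.
Proof. by apply/matrixP => i j; rewrite !mxE rmorphM. Qed.

Lemma sqnormZ n r (x : 'cV[F]_n) : sqnorm (iota r *: x) = r ^+ 2 * sqnorm x.
Proof.
rewrite /sqnorm mulr_sumr; apply: eq_bigr => i _.
by rewrite mxE nrmM exprMn nrm_iota_sqr.
Qed.

(** * Deflation and the rank-one decomposition *)

Lemma psd_eigenvector n (A : 'M[F]_n) : psdmx cj A -> A != 0 ->
  exists x : 'cV[F]_n, x != 0 /\ A *m x = iota (sqnorm x) *: x.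
Proof.
move=> [Aherm Apsd] /(eigenpair Aherm)[l [v [l0 v0 Av]]].
have v_gt0 : 0 < sqnorm v by rewrite lt_def sqnorm_eq0 v0 sqnorm_ge0.
(* Positivity of [A] at [v] reads 0 <= l |v|_2^2. *)
have l_gt0 : 0 < l.
  rewrite lt_def l0 /=; have := Apsd v.
  rewrite -mulmxA Av -scalemxAr ctmx_mul scale_scalar_mx mxE eqxx mulr1n.
  by rewrite -rmorphM iota_ge0 pmulr_lge0.
(* Scaling [v] by [s] turns its squared norm into [l], so that x x^* is exactly the spectral term of
   [A] along [v]. *)
pose s := Num.sqrt (l / sqnorm v); have lv_gt0 : 0 < l / sqnorm v by exact: divr_gt0.
exists (iota s *: v); split.
  by rewrite scaler_eq0 negb_or v0 fmorph_eq0 sqrtr_eq0 -ltNge lv_gt0.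
rewrite sqnormZ sqr_sqrtr ?ltW // divfK ?lt0r_neq0 //.
by rewrite -scalemxAr Av !scalerA mulrC.
Qed.

Lemma deflation_psd n (A : 'M[F]_n) (x : 'cV[F]_n) : psdmx cj A ->
  x != 0 -> A *m x = iota (sqnorm x) *: x -> psdmx cj (A - x *m x ^t cj).
Proof.
move=> [Aherm Apsd] x0 Ax; set B := A - _.
have Bherm : B ^t cj = B.
  by rewrite ctmxD ctmxN Aherm ctmxM ctmxK.
have Bx : B *m x = 0.
  by rewrite mulmxBl Ax -mulmxA ctmx_mul mul_mx_scalar subrr.
have xB : x ^t cj *m B = 0.
  by rewrite -[B]Bherm -ctmxM Bx trmx0 map_mx0.
split=> // z.
(* Since B x = 0, z may be replaced by its component w orthogonal to x. *)
pose c := (x ^t cj *m z) 0 0 / iota (sqnorm x).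
pose w := z - c *: x.
have xw : x ^t cj *m w = 0.
  rewrite mulmxBr -scalemxAr ctmx_mul scale_scalar_mx divfK.
    by rewrite [X in X - _]mx11_scalar subrr.
  by rewrite fmorph_eq0 sqnorm_eq0.
have Bw : B *m w = A *m w by rewrite mulmxBl -mulmxA xw mulmx0 subr0.
have -> : z ^t cj *m B *m z = w ^t cj *m A *m w.
  have -> : z = w + c *: x by rewrite subrK.
  rewrite ctmxD ctmxZ mulmxDl -scalemxAl xB scaler0 addr0.
  rewrite mulmxDr -scalemxAr -[X in _ + _ *: X]mulmxA Bx mulmx0 scaler0 addr0.
  by rewrite -!mulmxA Bw.
exact: Apsd.
Qed.

(** The row x^* lies in the row space of [A], because x^* A = |x|_2^2 x^*. So the row space of [B]
    is contained in that of [A]; it misses x^*, since [B] kills [x] while x^* x is nonzero. *)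
Lemma deflation_rank n (A : 'M[F]_n) (x : 'cV[F]_n) : A ^t cj = A ->
  x != 0 -> A *m x = iota (sqnorm x) *: x ->
  (\rank (A - x *m x ^t cj)%R < \rank A)%N.
Proof.
move=> Aherm x0 Ax; set B := A - _.
have s0 : iota (sqnorm x) != 0 by rewrite fmorph_eq0 sqnorm_eq0.
have xA : (x ^t cj <= A)%MS.
  apply/submxP; exists ((iota (sqnorm x))^-1 *: x ^t cj).
  rewrite -scalemxAl -[X in _ *m X]Aherm -ctmxM Ax ctmxZ cj_iota.
  by rewrite scalerA mulVf // scale1r.
have BA : (B <= A)%MS.
  by rewrite addmx_sub // eqmx_opp (submx_trans _ xA) // submxMl.
apply: rank_ltmx; rewrite /ltmx BA /=; apply: contra x0 => AB.
have /submxP[D xD] := submx_trans xA AB.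
have := ctmx_mul x; rewrite xD -mulmxA mulmxBl Ax -mulmxA ctmx_mul.
rewrite mul_mx_scalar subrr mulmx0 => /esym/eqP.
by rewrite -sqnorm_eq0 -(fmorph_eq0 iota) => /eqP/matrixP/(_ 0 0); rewrite !mxE mulr1n => ->.
Qed.

(** Induction on a bound for the rank. The vectors found for the deflated matrix remain eigenvectors
    of [A] itself because they are orthogonal to [x]. *)
Lemma psd_decomposition r n (A : 'M[F]_n) : psdmx cj A -> (\rank A <= r)%N ->
  exists N (x : 'I_N -> 'cV[F]_n), [/\ (N <= r)%N,
    A = \sum_k x k *m (x k) ^t cj &
    forall k, A *m x k = iota (sqnorm (x k)) *: x k].
Proof.
elim: r A => [|r IHr] A Apsd rA; have [A0|A0] := eqVneq A 0;
  (* The zero matrix gets the empty sum, in the base case and in the inductive step alike. *)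
  try (by exists 0%N, (fun=> 0); split=> [||[]] //; rewrite big_ord0).
  by move: rA; rewrite leqn0 mxrank_eq0 (negPf A0).
have [x [x0 Ax]] := psd_eigenvector Apsd A0.
have rB := leq_trans (deflation_rank Apsd.1 x0 Ax) rA.
have [N [y [Nr By yB]]] := IHr _ (deflation_psd Apsd x0 Ax) rB.
have xB : x ^t cj *m (A - x *m x ^t cj) = 0.
  rewrite mulmxBr mulmxA ctmx_mul mul_scalar_mx -[X in _ *m X]Apsd.1 -ctmxM Ax.
  by rewrite ctmxZ cj_iota subrr.
exists N.+1, (fun k => oapp y x (unlift ord0 k)); split=> //.
  rewrite big_ord_recl unlift_none /=; under eq_bigr do rewrite liftK /=.
  by rewrite -By addrC subrK.
move=> k; case: unliftP => [j _|_] //=.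
have [->|y0] := eqVneq (y j) 0; first by rewrite mulmx0 scaler0.
(* Pairing the eigenvector equation of [y j] with x^*, which annihilates the deflated matrix, gives
   |y|_2^2 x^* y = 0. Hence x^* y = 0, and [A] acts on [y j] as the deflated matrix does. *)
have /eqP := congr1 (mulmx (x ^t cj)) (yB j).
rewrite mulmxA xB mul0mx -scalemxAr eq_sym scaler_eq0 fmorph_eq0 sqnorm_eq0.
rewrite (negPf y0) /= => /eqP xy.
by rewrite -yB mulmxBl -[x *m _ *m _]mulmxA xy mulmx0 subr0.
Qed.

(** * Norm estimates and the bound on [gamma_plus] *)

Lemma norm1_sqr_le n (x : 'cV[F]_n) : norm1 nrm x ^+ 2 <= n%:R * sqnorm x.
Proof. exact: sqr_sum_le. Qed.

Lemma norm1_ge0 n (x : 'cV[F]_n) : 0 <= norm1 nrm x.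
Proof. exact: sumr_ge0. Qed.

Lemma norm11_ge0 n (A : 'M[F]_n) : 0 <= norm11 nrm A.
Proof. by apply: sumr_ge0 => i _; exact: sumr_ge0. Qed.

Lemma nrm_coord_le n (x : 'cV[F]_n) i : nrm (x i 0) <= Num.sqrt (sqnorm x).
Proof.
rewrite -[leLHS]ger0_norm // -sqrtr_sqr ler_sqrt ?sqnorm_ge0 //.
by rewrite /sqnorm (bigD1 i) //= lerDl sumr_ge0 // => j _; exact: sqr_ge0.
Qed.

Lemma norm1_mulmx n (A : 'M[F]_n) (x : 'cV[F]_n) :
  norm1 nrm (A *m x) <= norm11 nrm A * Num.sqrt (sqnorm x).
Proof.
rewrite /norm11 mulr_suml; apply: ler_sum => i _.
rewrite mxE; apply: le_trans (nrm_sum _ _) _.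
rewrite mulr_suml; apply: ler_sum => j _.
by rewrite nrmM ler_wpM2l // nrm_coord_le.
Qed.

Lemma norm1_eigenvector n (A : 'M[F]_n) (x : 'cV[F]_n) :
  A *m x = iota (sqnorm x) *: x ->
  norm1 nrm x ^+ 2 <= Num.sqrt n%:R * norm11 nrm A.
Proof.
(* The zero vector is set apart because the main argument cancels a factor [sqnorm x]. *)
move=> Ax; have [x0|x0] := eqVneq (sqnorm x) 0.
  have := norm1_sqr_le x; rewrite x0 mulr0 => /le_trans; apply.
  by rewrite mulr_ge0 ?sqrtr_ge0 ?norm11_ge0.
have s_gt0 : 0 < sqnorm x by rewrite lt_def x0 sqnorm_ge0.
have le1 : norm1 nrm x <= Num.sqrt n%:R * Num.sqrt (sqnorm x).
  rewrite -sqrtrM ?ler0n // -[leLHS]ger0_norm ?norm1_ge0 // -sqrtr_sqr.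
  by rewrite ler_sqrt ?norm1_sqr_le // mulr_ge0 ?sqnorm_ge0.
have le2 : sqnorm x * norm1 nrm x <= norm11 nrm A * Num.sqrt (sqnorm x).
  apply: le_trans (norm1_mulmx A x).
  rewrite Ax /norm1 mulr_sumr ler_sum // => i _.
  by rewrite mxE nrmM nrm_iota ?sqnorm_ge0.
(* After multiplication by [sqnorm x] the claim is the product of [le2] and [le1], whose two square
   roots recombine into [sqnorm x]. *)
rewrite -(ler_pM2l s_gt0) expr2 mulrA.
apply: le_trans (ler_pM _ (norm1_ge0 x) le2 le1) _.
  by rewrite mulr_ge0 ?norm1_ge0 ?ltW.
rewrite -[X in _ <= X * _](sqr_sqrtr (ltW s_gt0)).
by rewrite le_eqVlt; apply/orP; left; apply/eqP; ring.
Qed.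

(** The left side is the trace of the matrix. Its diagonal entries are nonnegative reals, hence
    equal to their moduli, and the off-diagonal moduli only add to the right side. *)
Lemma sum_sqnorm_le n N (x : 'I_N -> 'cV[F]_n) :
  \sum_k sqnorm (x k) <= norm11 nrm (\sum_k x k *m (x k) ^t cj).
Proof.
rewrite /sqnorm exchange_big /=; apply: ler_sum => i _.
rewrite (bigD1 i) //= -[leLHS]addr0 lerD ?sumr_ge0 //.
have -> : (\sum_k x k *m (x k) ^t cj) i i = iota (\sum_k nrm (x k i 0) ^+ 2).
  rewrite summxE rmorph_sum; apply: eq_bigr => k _.
  by rewrite mxE big_ord1 !mxE mulrC cj_mul.
by rewrite nrm_iota // sumr_ge0 // => k _; exact: sqr_ge0.
Qed.

Lemma gamma_plus_le n (A : 'M[F]_n) : psdmx cj A ->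
  (gamma_plus cj nrm A <=
    (Num.sqrt n%:R * Num.min (\rank A)%:R (Num.sqrt n%:R) * norm11 nrm A)%:E)%E.
Proof.
move=> Apsd; have [N [x [Nr Ax xA]]] := psd_decomposition Apsd (leqnn _).
apply: (@le_trans _ _ (\sum_k norm1 nrm (x k) ^+ 2)%:E).
  by apply: ereal_inf_lbound; exists N, x.
(* If the rank is the minimum, each of the at most [\rank A] terms is bounded separately; otherwise
   the prefactor is n and the trace bounds the whole sum. *)
rewrite lee_fin; case: (leP (\rank A)%:R (Num.sqrt n%:R)) => _.
  rewrite mulrAC; apply: (@le_trans _ _ (\sum_(k < N) Num.sqrt n%:R * norm11 nrm A)).
    by apply: ler_sum => k _; exact: norm1_eigenvector.
  rewrite sumr_const card_ord -[leLHS]mulr_natr ler_wpM2l ?ler_nat //.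
  by rewrite mulr_ge0 ?sqrtr_ge0 ?norm11_ge0.
rewrite -expr2 sqr_sqrtr ?ler0n //.
apply: (@le_trans _ _ (\sum_k n%:R * sqnorm (x k))).
  by apply: ler_sum => k _; exact: norm1_sqr_le.
by rewrite -mulr_sumr ler_wpM2l // [in leRHS]Ax sum_sqnorm_le.
Qed.

End ScalarField.

(** * Nonzero eigenvalues of Hermitian and real symmetric matrices *)

Lemma hermitian_eigenpair (C : numClosedFieldType) n (A : 'M[C]_n) :
  A ^t Num.conj = A -> A != 0 ->
  exists l (v : 'cV[C]_n), [/\ l \is Num.real, l != 0, v != 0 & A *m v = l *: v].
Proof.
move=> Aherm A0.
have Ah : A \is hermsymmx by apply/is_hermitianmxP; rewrite expr0 scale1r Aherm.
have /orthomx_spectralP := hermitian_normalmx Ah.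
have /mxOverP Dreal := hermitian_spectral_diag_real Ah.
set P := spectralmx A; set D := spectral_diag A in Dreal * => AE.
have Pu : P \in unitmx by exact: spectral_unit.
(* If the spectral diagonal vanished, so would [A]. *)
have [i Di] : exists i, D 0 i != 0.
  apply/existsP; apply: contraNT A0 => /existsPn D0.
  have D_0 : D = 0.
    by apply/rowP => i; have := D0 i; rewrite negbK mxE => /eqP.
  by rewrite AE D_0 raddf0 mulmx0 mul0mx.
(* The eigenvector is column [i] of the inverse of the diagonalising matrix. *)
exists (D 0 i), (invmx P *m delta_mx i 0); split=> //.
  apply/eqP => /(congr1 (mulmx P)); rewrite mulKVmx // mulmx0.
  move/matrixP/(_ i 0)/eqP.
  by rewrite !mxE !eqxx oner_eq0.
rewrite {1}AE -!mulmxA mulKVmx // scalemxAr; congr (_ *m _).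
apply/colP => j; rewrite mul_diag_mx !mxE eqxx andbT.
by case: eqP => [->|_] //; rewrite !mulr0.
Qed.

Lemma complex_hermitian_eigenpair (R : realType) n (A : 'M[R[i]]_n) :
  A ^t Num.conj = A -> A != 0 ->
  exists (l : R) (v : 'cV[R[i]]_n),
    [/\ l != 0, v != 0 & A *m v = real_complex R l *: v].
Proof.
move=> Aherm /(hermitian_eigenpair Aherm)[l [v [/complex_realP[r ->]]]].
by rewrite fmorph_eq0 => r0 v0 Av; exists r, v.
Qed.

(* The real or the imaginary part of a complex eigenvector is a real one. *)
Lemma real_symmetric_eigenpair (R : realType) n (A : 'M[R]_n) :
  A ^t idfun = A -> A != 0 ->
  exists l (v : 'cV[R]_n), [/\ l != 0, v != 0 & A *m v = l *: v].
Proof.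
rewrite map_mx_id // => Asym A0.
pose AC := map_mx (real_complex R) A.
have ACherm : AC ^t Num.conj = AC.
  apply/matrixP => i j; rewrite !mxE -[in RHS]Asym mxE.
  by apply/conj_Creal/complex_realP; exists (A j i).
have AC0 : AC != 0 by rewrite map_mx_eq0.
have [l [v [l0 v0 ACv]]] := complex_hermitian_eigenpair ACherm AC0.
(* As [A] and [l] are real, the eigenvector equation splits into its real and imaginary parts. *)
have Re_Im i : (A *m map_mx (@complex.Re R) v) i 0 = l * complex.Re (v i 0) /\
               (A *m map_mx (@complex.Im R) v) i 0 = l * complex.Im (v i 0).
  have /matrixP/(_ i 0) := ACv; rewrite !mxE => E.
  have scale (r : R) (z : R[i]) : complex.Re (real_complex R r * z) = r * complex.Re z /\
      complex.Im (real_complex R r * z) = r * complex.Im z.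
    by case: z => a b /=; rewrite !mul0r subr0 addr0.
  have := congr1 (@complex.Re R) E; have := congr1 (@complex.Im R) E.
  rewrite !(scale l _).1 !(scale l _).2.
  rewrite (big_morph (@complex.Im R) (id1 := 0) (op1 := +%R)) => [|[? ?] [? ?]|] //.
  rewrite (big_morph (@complex.Re R) (id1 := 0) (op1 := +%R)) => [|[? ?] [? ?]|] //.
  move=> <- <-; split; apply: eq_bigr => j _; rewrite !mxE.
    by rewrite (scale (A i j) (v j 0)).1.
  by rewrite (scale (A i j) (v j 0)).2.
have [a0|a0] := eqVneq (map_mx (@complex.Re R) v) 0; last first.
  exists l, (map_mx (@complex.Re R) v); split=> //.
  by apply/colP => i; rewrite (Re_Im i).1 !mxE.
exists l, (map_mx (@complex.Im R) v); split=> //.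
  apply: contra v0 => /eqP b0; apply/eqP/colP => i.
  move/colP/(_ i): a0; move/colP/(_ i): b0; rewrite !mxE.
  by case: (v i 0) => a b /= -> ->.
by apply/colP => i; rewrite (Re_Im i).2 !mxE.
Qed.

Theorem corollary2p5 (R : realType) :
  (forall (n : nat) (A : 'M[R]_n), psdmx idfun A -> A != 0 ->
     (gamma_plus idfun Num.norm A <=
       (Num.sqrt n%:R * Num.min (\rank A)%:R (Num.sqrt n%:R) *
          norm11 Num.norm A)%:E)%E) /\
  (forall (n : nat) (A : 'M[R[i]]_n), psdmx Num.conj A -> A != 0 ->
     (gamma_plus Num.conj (@Normc.normc R) A <=
       (Num.sqrt n%:R * Num.min (\rank A)%:R (Num.sqrt n%:R) *
          norm11 (@Normc.normc R) A)%:E)%E).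
Proof.
split=> n A Apsd _.
  (* Over the reals, both the conjugation and the embedding are the identity. *)
  apply: (@gamma_plus_le R R idfun Num.norm idfun) => //.
  - by move=> z; rewrite /= real_normK ?num_real.
  - exact: normrM.
  - exact: ler_normD.
  - exact: real_symmetric_eigenpair.
apply: (@gamma_plus_le R R[i] Num.conj (@Normc.normc R) (real_complex R)) => //.
- exact: conjCK.
- by move=> r; apply/conj_Creal/complex_realP; exists r.
- exact: ler0c.
- by move=> z; rewrite mulrC -normCK rmorphXn.
- by case=> a b; exact: sqrtr_ge0.
- exact: Normc.normcM.
(* The triangle inequality holds for the norm valued in [R[i]]; [lecR] brings it down to [R]. *)
- by move=> y z; rewrite -lecR rmorphD; exact: (ler_normD y z).
- exact: complex_hermitian_eigenpair.
Qed.
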